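(* Let $\mathbb{F}$ be a field. Every full subcomplex of a finite simplicial complex that is weakly taut over $\mathbb{F}$ is itself weakly taut over $\mathbb{F}$.
   Context: A finite simplicial complex $K$ with vertex set $V(K)=[m]=\{v_1,\dots,v_m\}$ ($m\ge 0$) contains $\varnothing$ and every singleton $\{v_i\}$ as a face; for $m=0$, $K=\{\varnothing\}$. For $J\subseteq V(K)$, the full subcomplex $K|_J$ consists of all faces of $K$ contained in $J$; its vertex set is $J$. The dimension of a face $\sigma$ is $|\sigma|-1$, and $\mathrm{mdim}(K)$ is the minimal dimension of the maximal (by inclusion) simplices of $K$ (so $\mathrm{mdim}(\{\varnothing\})=-1$). For a field $\mathbb{F}$, $\mathbb{F}[K]=\mathbb{F}[v_1,\dots,v_m]/\mathcal{I}_K$ is the Stanley-Reisner ring and $\widetilde{D}(K;\mathbb{F})=\dim_{\mathbb{F}}\mathrm{Tor}_{\mathbb{F}[v_1,\dots,v_m]}(\mathbb{F}[K],\mathbb{F})$; equivalently (Hochster's formula) $\widetilde{D}(K;\mathbb{F})=\sum_{J\subseteq[m]}\sum_{i\ge -1}\dim_{\mathbb{F}}\widetilde{H}_i(K|_J;\mathbb{F})$, where $\widetilde{H}_{-1}(\{\varnothing\};\mathbb{F})=\mathbb{F}$ is the only nonzero reduced homology group of $\{\varnothing\}$. $K$ with $m$ vertices is weakly taut over $\mathbb{F}$ if $\widetilde{D}(K;\mathbb{F})=2^{m-\mathrm{mdim}(K)-1}$. *)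

(* Defs.v *)
From HB Require Import structures.
From mathcomp Require Import all_boot all_order all_algebra.
From mathcomp Require Import mpoly.

Set Implicit Arguments.
Unset Strict Implicit.
Unset Printing Implicit Defensive.

Import GRing.Theory.

Local Open Scope ring_scope.

(* A simplicial complex with vertex set exactly [m]: there are no ghost       *)
(* vertices, since every singleton is a face.                                 *)
Record simplicial_complex (m : nat) := SimplicialComplex {
  faces : {set {set 'I_m}};
  faces_set0 : set0 \in faces;
  faces_set1 : forall i : 'I_m, [set i] \in faces;
  faces_sub : forall s t : {set 'I_m},
    t \subset s -> s \in faces -> t \in faces
}.

Section FullSubcomplex.
Variables (m : nat) (K : simplicial_complex m) (J : {set 'I_m}).

(* The elements of J are relabelled 0, ..., #|J| - 1 through the increasing   *)
(* enumeration enum_val : 'I_#|J| -> 'I_m of J.                               *)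
Definition full_faces : {set {set 'I_#|J|}} :=
  [set s : {set 'I_#|J|} | [set enum_val j | j in s] \in faces K].

Lemma full_faces_set0 : set0 \in full_faces.
Proof. by rewrite inE imset0 faces_set0. Qed.

Lemma full_faces_set1 (j : 'I_#|J|) : [set j] \in full_faces.
Proof. by rewrite inE imset_set1 faces_set1. Qed.

Lemma full_faces_sub (s t : {set 'I_#|J|}) :
  t \subset s -> s \in full_faces -> t \in full_faces.
Proof. by rewrite !inE => /imsetS ts; apply: faces_sub (ts _ _). Qed.

Definition full_subcomplex : simplicial_complex #|J| :=
  SimplicialComplex full_faces_set0 full_faces_set1 full_faces_sub.

End FullSubcomplex.

Definition facets (m : nat) (K : simplicial_complex m) : {set {set 'I_m}} :=
  [set s | maxset [pred t | t \in faces K] s].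

(* Every facet has at most m elements and the set of facets is nonempty, so   *)
(* the default value m of the iterated minimum is harmless.                   *)
Definition mdim (m : nat) (K : simplicial_complex m) : int :=
  (\big[minn/m]_(s in facets K) #|s|)%N%:Z - 1.

Definition SR_ideal (F : fieldType) (m : nat) (K : simplicial_complex m)
    (p : {mpoly F[m]}) : Prop :=
  exists c : {set 'I_m} -> {mpoly F[m]},
    p = \sum_(s | s \notin faces K) c s * \prod_(i in s) 'X_i.

(* For an ideal I of S = F[v_1, ..., v_m], a resolution                       *)
(*   ... -> S^(rk 2) -> S^(rk 1) -> S^(rk 0) -> S/I -> 0                      *)
(* of the S-module S/I by free modules of finite rank. Elements of S^n are    *)
(* row vectors and matrices act on the right. The augmentation is given by a  *)
(* column of representatives in S: it maps v to the class of v *m res_aug.    *)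
Record free_resolution (F : fieldType) (m : nat) (I : {mpoly F[m]} -> Prop) :=
  FreeResolution {
  res_rk : nat -> nat;
  res_aug : 'cV[{mpoly F[m]}]_(res_rk 0);
  res_diff : forall i : nat, 'M[{mpoly F[m]}]_(res_rk i.+1, res_rk i);
  res_aug_surj : forall p : {mpoly F[m]},
    exists v : 'rV[{mpoly F[m]}]_(res_rk 0), I ((v *m res_aug) 0 0 - p);
  res_exact0 : forall v : 'rV[{mpoly F[m]}]_(res_rk 0),
    I ((v *m res_aug) 0 0) <->
    exists w : 'rV[{mpoly F[m]}]_(res_rk 1), v = w *m res_diff 0;
  res_exactS : forall (i : nat) (v : 'rV[{mpoly F[m]}]_(res_rk i.+1)),
    v *m res_diff i = 0 <->
    exists w : 'rV[{mpoly F[m]}]_(res_rk i.+2), v = w *m res_diff i.+1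
}.

Section Tor.
Variables (F : fieldType) (m : nat) (I : {mpoly F[m]} -> Prop).

(* The S-module F is S/(v_1, ..., v_m), so S^n (x)_S F = F^n and a matrix     *)
(* over S induces the matrix of its constant terms.                           *)
Definition tensor_diff (P : free_resolution I) (i : nat) :
    'M[F]_(res_rk P i.+1, res_rk P i) :=
  map_mx (fun p : {mpoly F[m]} => p@_0%MM) (res_diff P i).

(* The dimension of Tor_i(S/I, F) as the i-th homology of P (x)_S F; the      *)
(* boundaries form a subspace of the cycles, so the subtractions are exact.   *)
Definition dim_Tor (P : free_resolution I) (i : nat) : nat :=
  match i with
  | 0 => res_rk P 0 - \rank (tensor_diff P 0)
  | j.+1 => \rank (kermx (tensor_diff P j)) - \rank (tensor_diff P j.+1)
  end%N.

(* The total dimension of Tor(S/I, F), the direct sum of all Tor_i(S/I, F),   *)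
(* is finite and equal to d. As usual, Tor is computed from some resolution   *)
(* and does not depend on its choice.                                         *)
Definition total_dim_Tor (d : nat) : Prop :=
  exists (P : free_resolution I) (n : nat),
    (forall i : nat, (n <= i)%N -> dim_Tor P i = 0%N) /\
    d = (\sum_(i < n) dim_Tor P i)%N.

End Tor.

(* The exponent and the power are taken in int and rat, so that no truncated  *)
(* subtraction is involved.                                                   *)
Definition weakly_taut (F : fieldType) (m : nat) (K : simplicial_complex m) :
    Prop :=
  exists d : nat, total_dim_Tor (@SR_ideal F m K) d /\
    d%:R = 2%:R ^ (m%:Z - mdim K - 1) :> rat.

(* Main.v *)
(* Write [N] for the set of minimal nonfaces. A complex turns out to be       *)
(* weakly taut exactly when, for some [s], the map [g |-> g :\: s] is        *)
(* injective on [N] with singleton values, and this property passes to full   *)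
(* subcomplexes.                                                              *)
(*                                                                            *)
(* Let [s] be a facet, [k = m - #|s|], and [P] any free resolution of [S/I].  *)
(* The Koszul complex on the [x^s x_j], [j \notin s], maps to [P], and [P]   *)
(* maps to the Koszul complex on the [x_j]; the composite is homotopic to a   *)
(* diagonal map whose entries are powers of [x^s]. Specializing [x_i |-> t]   *)
(* on [s] and [x_j |-> 0] off [s] makes both Koszul differentials zero and    *)
(* the composite invertible over [F(t)]; since ranks can only drop at         *)
(* [t = 0], this gives [dim Tor_i >= 'C(k, i)].                               *)
(*                                                                            *)
(* If the total dimension is [2 ^ k], all these bounds are equalities, so     *)
(* [#|N| = dim Tor_1 = k]. As [j |: s] contains a minimal nonface through [j] *)
(* for each [j \notin s], there are no others. Conversely, if [s] has the    *)
(* property above, then some facet has [m - #|N|] elements, and a resolution  *)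
(* with ranks ['C(#|N|, i)], obtained from iterated mapping cones, attains    *)
(* the bounds.                                                                *)

From HB Require Import structures.
From Stdlib Require Import IndefiniteDescription.
Require Import Defs.
From mathcomp Require Import all_boot all_order all_algebra.
From mathcomp Require Import mpoly.

Set Implicit Arguments.
Unset Strict Implicit.
Unset Printing Implicit Defensive.

Import GRing.Theory Num.Theory.

Local Open Scope ring_scope.

(** Weak tautness says that a lower bound for the total Tor dimension is attained, and this is
    visible in the minimal nonfaces alone: [weakly_taut_split] reads [split_nonfaces] off Tor in
    degree 1, and [split_weakly_taut] goes back. The passage to [J] is then purely combinatorial,
    since minimal nonfaces of a full subcomplex are minimal nonfaces of the whole complex. The lower
    bound is [dim_Tor_ge_binomial], the count in degree 1 is [dim_Tor1_ge_card], and
    [exists_resolution] supplies the matching upper bound. *)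

(** Used to build chain maps degree by degree; [ok] is the invariant that lets the construction
    continue. *)
Lemma dependent_choice (T : nat -> Type) (ok : forall i, T i -> Prop)
    (step : forall i, T i -> T i.+1 -> Prop) (x0 : T 0) :
  ok 0 x0 ->
  (forall i x, ok i x -> exists2 y, ok i.+1 y & step i x y) ->
  exists2 f : forall i, T i, f 0 = x0 & forall i, step i (f i) (f i.+1).
Proof.
move=> ok0 next.
have nextS i (x : {x | ok i x}) : {y | ok i.+1 y /\ step i (sval x) y}.
  apply: constructive_indefinite_description.
  by case: x => x okx; have [y oky xy] := next i x okx; exists y.
pose g := nat_rect (fun i => {x | ok i x}) (exist _ x0 ok0)
  (fun i x => exist _ (sval (nextS i x)) (proj1 (svalP (nextS i x)))).
exists (fun i => sval (g i)) => // i.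
exact: proj2 (svalP (nextS i (g i))).
Qed.

(** * Free resolutions and comparison of chain maps *)

Section Complexes.
Variable S : comNzRingType.

Record ideal (I : S -> Prop) : Prop := Ideal {
  ideal0 : I 0;
  idealD : forall p q, I p -> I q -> I (p + q);
  idealM : forall c p, I p -> I (c * p)
}.

Lemma idealN (I : S -> Prop) p : ideal I -> I p -> I (- p).
Proof. by move=> idI Ip; rewrite -mulN1r; apply: idealM. Qed.

Lemma idealB (I : S -> Prop) p q : ideal I -> I p -> I q -> I (p - q).
Proof. by move=> idI Ip Iq; apply: idealD => //; apply: idealN. Qed.

Lemma idealBC (I : S -> Prop) p q : ideal I -> I (p - q) -> I (q - p).
Proof. by move=> idI Ipq; rewrite -opprB; apply: idealN. Qed.

Lemma ideal_trans (I : S -> Prop) p q r :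
  ideal I -> I (p - q) -> I (q - r) -> I (p - r).
Proof. by move=> idI /idealD -/[apply] /(_ idI); rewrite addrA subrK. Qed.

Lemma ideal_subl (I : S -> Prop) p q : ideal I -> I (p - q) -> I q -> I p.
Proof. by move=> idI /idealD -/[apply] /(_ idI); rewrite subrK. Qed.

(** That consecutive differentials compose to zero is not a field: it follows from exactness in
    [resolves_sq0] and is computed for Koszul complexes in [koszul_sq0]. *)
Record cplx := Cplx {
  rk : nat -> nat;
  aug : 'cV[S]_(rk 0);
  df : forall i, 'M[S]_(rk i.+1, rk i)
}.

Definition augment (C : cplx) (v : 'rV[S]_(rk C 0)) : S := (v *m aug C) 0 0.
Arguments augment : clear implicits.

Lemma augmentD C v w : augment C (v + w) = augment C v + augment C w.
Proof. by rewrite /augment mulmxDl mxE. Qed.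

Lemma augmentN C v : augment C (- v) = - augment C v.
Proof. by rewrite /augment mulNmx mxE. Qed.

Record resolves (I : S -> Prop) (C : cplx) : Prop := Resolves {
  resolves_surj : forall p, exists v, I (augment C v - p);
  resolves0 : forall v, I (augment C v) <-> exists w, v = w *m df C 0;
  resolvesS : forall i (v : 'rV_(rk C i.+1)),
    v *m df C i = 0 <-> exists w, v = w *m df C i.+1
}.

Lemma eq_resolves (I I' : S -> Prop) C :
  (forall p, I p <-> I' p) -> resolves I C -> resolves I' C.
Proof.
move=> eqI [surjC exC0 exCS]; split=> // [p|v].
  by have [v /eqI] := surjC p; exists v.
by split=> [/eqI/exC0|/exC0/eqI].
Qed.

Definition chain_map (C D : cplx) (f : forall i, 'M[S]_(rk C i, rk D i)) :=
  forall i, df C i *m f i = f i.+1 *m df D i.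

Lemma mx_rowwise k n p (A : 'M[S]_(k, n)) (B : 'M_(p, n)) :
  (forall v : 'rV_k, exists w, v *m A = w *m B) -> exists W, A = W *m B.
Proof.
move=> H; have /fin_all_exists[W defW] : forall i, exists w, row i A = w *m B.
  by move=> i; have [w] := H (delta_mx 0 i); rewrite -rowE; exists w.
by exists (\matrix_i W i); apply/row_matrixP => i; rewrite row_mul rowK.
Qed.

Lemma resolves_lift I C k i (A : 'M[S]_(k, rk C i.+1)) :
  resolves I C -> A *m df C i = 0 -> exists W, A = W *m df C i.+1.
Proof.
move=> resC A0; apply: mx_rowwise => v.
by apply/(resolvesS resC); rewrite -mulmxA A0 mulmx0.
Qed.

Lemma resolves_lift0 I C k (A : 'M[S]_(k, rk C 0)) :
  resolves I C -> (forall v : 'rV_k, I (augment C (v *m A))) ->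
  exists W, A = W *m df C 0.
Proof.
by move=> resC A0; apply: mx_rowwise => v; apply/(resolves0 resC).
Qed.

Lemma resolves_sq0 I C i : resolves I C -> df C i.+1 *m df C i = 0.
Proof.
move=> resC; apply/row_matrixP => j; rewrite row_mul row0.
by apply/(resolvesS resC); exists (delta_mx 0 j); rewrite -rowE.
Qed.

Lemma resolves_aug0 I C v : resolves I C -> I (augment C (v *m df C 0)).
Proof. by move=> resC; apply/(resolves0 resC); exists v. Qed.

(* Comparison theorem: the target augmentation [a] is lifted to [D]. *)
Lemma lift_chain_map I C D (a : 'cV[S]_(rk C 0)) :
    ideal I -> resolves I D -> (forall i, df C i.+1 *m df C i = 0) ->
    (forall v : 'rV_(rk C 1), I ((v *m df C 0 *m a) 0 0)) ->
  exists2 f : forall i, 'M[S]_(rk C i, rk D i), chain_map f &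
    forall v : 'rV_(rk C 0), I (augment D (v *m f 0) - (v *m a) 0 0).
Proof.
move=> idI resD sq0 aI.
have /fin_all_exists[F0 F0P] : forall j, exists v, I (augment D v - a j 0).
  by move=> j; apply: resolves_surj.
pose f0 : 'M_(rk C 0, rk D 0) := \matrix_j F0 j.
have f0P v : I (augment D (v *m f0) - (v *m a) 0 0).
  have -> : augment D (v *m f0) - (v *m a) 0 0 = (v *m (f0 *m aug D - a)) 0 0.
    by rewrite mulmxBr mulmxA [RHS]mxE [X in _ = _ + X]mxE.
  rewrite mxE.
  apply: big_ind => [||j _]; [exact: ideal0 idI | exact: idealD idI |].
  apply: (idealM idI); rewrite mxE [X in _ + X]mxE.
  suff <- : augment D (F0 j) = (f0 *m aug D) j 0 by [].
  by rewrite /augment -[F0 j](rowK F0) -row_mul mxE.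
have [W1 W1P] : exists W, df C 0 *m f0 = W *m df D 0.
  apply: resolves_lift0 resD _ => v; rewrite mulmxA.
  exact: ideal_subl (f0P _) (aI v).
pose T i := ('M[S]_(rk C i, rk D i) * 'M[S]_(rk C i.+1, rk D i.+1))%type.
pose ok i (x : T i) := df C i *m x.1 = x.2 *m df D i.
have [||f f00 fS] :=
  @dependent_choice T ok (fun i x y => ok i x /\ x.2 = y.1) (f0, W1).
- exact: W1P.
- move=> i [g g'] gg'.
  have [W WP] : exists W, df C i.+1 *m g' = W *m df D i.+1.
    by apply: resolves_lift resD _; rewrite -mulmxA -gg' mulmxA sq0 mul0mx.
  by exists (g', W).
exists (fun i => (f i).1); last by move=> v; rewrite f00.
by move=> i; have [okf <-] := fS i.
Qed.

(** The factor of [df D] found in one degree is the homotopy component entering the next. Only the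
    existence of both matrices in each degree is recorded, which is enough once both differentials
    specialize to zero. *)
Lemma null_homotopy I C D (h : forall i, 'M[S]_(rk C i, rk D i)) :
    resolves I D -> (forall i, df C i.+1 *m df C i = 0) -> chain_map h ->
    (forall v : 'rV_(rk C 0), I (augment D (v *m h 0))) ->
  (exists W, h 0 = W *m df D 0) /\
  forall i, exists W W', h i.+1 = df C i *m W + W' *m df D i.+1.
Proof.
move=> resD sq0 ch h0.
have hW0 : exists W, h 0 = W *m df D 0 by apply: resolves_lift0 resD _.
split=> // i.
suff [W HW] : exists W, (h i.+1 - df C i *m W) *m df D i = 0.
  have [W' W'P] := resolves_lift resD HW.
  by exists W, W'; rewrite -W'P addrC subrK.
elim: i => [|i [W HW]].
  by have [W WP] := hW0; exists W; rewrite mulmxBl -mulmxA -WP ch subrr.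
have [W' W'P] := resolves_lift resD HW; exists W'.
rewrite mulmxBl -ch -mulmxA -W'P -mulmxBr opprB addrC subrK.
by rewrite mulmxA sq0 mul0mx.
Qed.

(** * Mapping cones and Koszul complexes *)

Section Cone.
Variables (P Q : cplx) (f : forall i, 'M[S]_(rk Q i, rk P i)).

Definition cone_rk i := if i is i'.+1 then (rk P i + rk Q i')%N else rk P 0.

(** The sign on [df Q] makes the two contributions of [f] cancel in the composite of consecutive
    differentials. *)
Definition cone_df i : 'M[S]_(cone_rk i.+1, cone_rk i) :=
  match i return 'M[S]_(cone_rk i.+1, cone_rk i) with
  | 0 => col_mx (df P 0) (f 0)
  | i'.+1 => block_mx (df P i'.+1) 0 (f i'.+1) (- df Q i')
  end.

Definition cone : cplx := Cplx (rk := cone_rk) (aug P) cone_df.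

(* The colon ideal [(I : x)] is [I'], and [f] lifts multiplication by [x]. *)
Lemma resolves_cone (I I' J : S -> Prop) x :
    ideal I -> (forall q, I' q <-> I (x * q)) ->
    (forall p, J p <-> exists q, I (p - x * q)) ->
    resolves I P -> resolves I' Q -> chain_map f ->
    (forall v : 'rV_(rk Q 0), I (augment P (v *m f 0) - x * augment Q v)) ->
  resolves J cone.
Proof.
move=> idI I'E JE resP resQ chf f0.
split.
- move=> p; have [v vp] := resolves_surj resP p; exists v.
  by apply/JE; exists 0; rewrite mulr0 subr0.
- move=> v; rewrite -[augment cone v]/(augment P v); split.
    case/JE=> q Iq; have [z zq] := resolves_surj resQ q.
    have : I (augment P (v - z *m f 0)).
      rewrite augmentD augmentN.
      have /I'E := zq; rewrite mulrBr => /(idealBC idI) Iz.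
      have Ivz := ideal_trans idI Iq Iz.
      exact: ideal_trans idI Ivz (idealBC idI (f0 z)).
    case/(resolves0 resP) => w vw; exists (row_mx w z).
    by rewrite mul_row_col -vw subrK.
  case=> w ->; rewrite -[w]hsubmxK mul_row_col augmentD.
  apply/JE; exists (augment Q (rsubmx w)); rewrite -addrA.
  by apply: idealD => //; apply: resolves_aug0.
- case=> [|i] v; split.
  + rewrite -[v]hsubmxK; set a := lsubmx v; set b := rsubmx v.
    rewrite [df cone 0]/= mul_row_col => ab0.
    have : I' (augment Q b).
      apply/I'E.
      have := f0 b; have /eqP := ab0; rewrite addrC addr_eq0 => /eqP ->.
      move=> H; rewrite -[_ * _]opprK; apply: idealN => //.
      have := idealB idI H (idealN idI (resolves_aug0 a resP)).
      by rewrite augmentN addrC opprK addrA subrr add0r.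
    case/(resolves0 resQ) => z bz.
    have : (a + z *m f 1) *m df P 0 = 0.
      by rewrite mulmxDl -mulmxA -chf mulmxA -bz.
    case/(resolvesS resP) => w aw.
    exists (row_mx w (- z)); rewrite [df cone 1]/= mul_row_block mulmx0 add0r.
    by rewrite -aw !mulNmx addrK mulmxN opprK -bz.
  + case=> w ->; rewrite -[w]hsubmxK [df cone 1]/= [df cone 0]/=.
    rewrite mul_row_block mulmx0 add0r mul_row_col mulmxDl.
    rewrite -mulmxA (resolves_sq0 0 resP) mulmx0 add0r.
    by rewrite mulmxN mulNmx -!mulmxA chf addrN.
  + rewrite -[v]hsubmxK; set a := lsubmx v; set b := rsubmx v.
    rewrite [df cone _]/= mul_row_block mulmx0 add0r.
    rewrite -[0]row_mx0 => /eq_row_mx[ab0].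
    rewrite mulmxN => /eqP; rewrite oppr_eq0 => /eqP b0.
    have [z bz] := (resolvesS resQ b).1 b0.
    have : (a + z *m f i.+2) *m df P i.+1 = 0.
      by rewrite mulmxDl -mulmxA -chf mulmxA -bz.
    case/(resolvesS resP) => w aw.
    exists (row_mx w (- z)); rewrite [df cone _]/= mul_row_block mulmx0 add0r.
    by rewrite -aw !mulNmx addrK mulmxN opprK -bz.
  + case=> w ->; rewrite -[w]hsubmxK ![df cone _]/=.
    rewrite !mul_row_block !mulmx0 !add0r !mulmxN !mulNmx !mulmxDl -!mulmxA.
    rewrite (resolves_sq0 _ resP) (resolves_sq0 _ resQ) chf !mulmx0 add0r.
    by rewrite addrN !oppr0 row_mx0.
Qed.

End Cone.
Fixpoint koszul (s : seq S) : cplx :=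
  if s is x :: s' then cone (fun i => x%:M : 'M_(rk (koszul s') i)) else
  Cplx (rk := fun i => (i == 0)%N : nat) 1%:M (fun i => 0).

Lemma koszul_chain_map (C : cplx) x :
  chain_map (fun i => x%:M : 'M_(rk C i)).
Proof. by move=> i; rewrite mul_scalar_mx mul_mx_scalar. Qed.

Lemma koszul_sq0 s i : df (koszul s) i.+1 *m df (koszul s) i = 0.
Proof.
elim: s i => [|x s IHs] [|i] /=; rewrite ?mulmx0 //.
  rewrite mul_block_col IHs mul0mx add0r mul_scalar_mx mul_mx_scalar.
  by rewrite scalerN addrN col_mx0.
rewrite mulmx_block !mul0mx !mulmx0 !addr0 !IHs add0r.
rewrite !mulNmx !mulmxN IHs !oppr0 mul_scalar_mx mul_mx_scalar.
by rewrite addrN block_mx0.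
Qed.

Lemma koszul_aug0 (I : S -> Prop) s (v : 'rV_(rk (koszul s) 1)) :
  ideal I -> (forall x, x \in s -> I x) ->
  I ((v *m df (koszul s) 0 *m aug (koszul s)) 0 0).
Proof.
move=> idI; elim: s v => [|x s IHs] v sI /=.
  by rewrite mulmx0 mul0mx mxE; apply: ideal0.
rewrite -[v]hsubmxK mul_row_col mulmxDl mxE; apply: (idealD idI).
  by apply: IHs => y ys; apply: sI; rewrite inE ys orbT.
rewrite mul_mx_scalar -scalemxAl mxE mulrC; apply: (idealM idI).
by apply: sI; rewrite mem_head.
Qed.

(* For [u = (u_1, ..., u_k)], the basis vector [e_A] of the Koszul complex on *)
(* the products [u_j x_j] is sent to [(\prod_(j in A) u_j) e_A].              *)
Fixpoint koszul_diag (s : seq (S * S)) :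
    forall i, 'M[S]_(rk (koszul [seq p.1 * p.2 | p <- s]) i,
                     rk (koszul [seq p.2 | p <- s]) i) :=
  match s with
  | [::] => fun i => 1%:M
  | p :: s' => fun i =>
    match i with
    | 0 => koszul_diag s' 0
    | i'.+1 => block_mx (koszul_diag s' i'.+1) 0 0 (p.1 *: koszul_diag s' i')
    end
  end.

Lemma koszul_diag_chain_map s : chain_map (koszul_diag s).
Proof.
elim: s => [|[u x] s IHs] [|i] /=; rewrite ?mul0mx ?mulmx0 //.
  rewrite mul_col_mx mul_block_col !mul0mx addr0 add0r IHs.
  by rewrite mul_scalar_mx mul_mx_scalar scalerA mulrC.
rewrite !mulmx_block !mulmx0 !mul0mx !addr0 !add0r IHs.
rewrite mul_scalar_mx mul_mx_scalar scalerA mulrC.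
by rewrite !mulNmx mulmxN -scalemxAl -scalemxAr IHs.
Qed.

Lemma koszul_diag_aug s :
  koszul_diag s 0 *m aug (koszul [seq p.2 | p <- s]) =
  aug (koszul [seq p.1 * p.2 | p <- s]).
Proof. by elim: s => [|[u x] s IHs] //=; rewrite mul1mx. Qed.

End Complexes.

Arguments augment {S} C v.

(** * Ranks over a field *)

Lemma map_koszul_df (S : comNzRingType) (E : fieldType)
    (psi : {rmorphism S -> E}) s i :
  (forall x, x \in s -> psi x = 0) -> map_mx psi (df (koszul s) i) = 0.
Proof.
elim: s i => [|x s IHs] i s0 /=; first exact: map_mx0.
have IH j : map_mx psi (df (koszul s) j) = 0.
  by apply: IHs => y ys; apply: s0; rewrite inE ys orbT.
have x0 n : map_mx psi (x%:M : 'M_n) = 0.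
  by rewrite map_scalar_mx [psi x]s0 ?mem_head ?raddf0.
case: i => [|i] /=.
  by rewrite map_col_mx IH x0 col_mx0.
by rewrite map_block_mx map_mxN map_mx0 !IH x0 oppr0 block_mx0.
Qed.

Lemma rank_koszul_diag (S : comNzRingType) (E : fieldType)
    (psi : {rmorphism S -> E}) s i :
  (forall p, p \in s -> psi p.1 != 0) ->
  \rank (map_mx psi (koszul_diag s i)) = 'C(size s, i).
Proof.
elim: s i => [|p s IHs] i u0 /=.
  by rewrite map_mx1 mxrank1; case: i.
have IH j : \rank (map_mx psi (koszul_diag s j)) = 'C(size s, j).
  by apply: IHs => q qs; apply: u0; rewrite inE qs orbT.
case: i => [|i]; first by rewrite IH !bin0.
rewrite map_block_mx !map_mx0 rank_diag_block_mx map_mxZ.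
by rewrite mxrank_scale_nz ?u0 ?mem_head // !IH binS.
Qed.

(** The image of [f] consists of cycles and [g] kills boundaries, so the rank of [f *m g] is bounded
    by the dimension of the homology at the middle space. *)
Lemma mxrank_factor_homology (E : fieldType) c q n p e
    (f : 'M[E]_(c, n)) (B : 'M_(q, n)) (A : 'M_(n, p)) (g : 'M_(n, e)) :
  f *m A = 0 -> B *m A = 0 -> B *m g = 0 ->
  (\rank (f *m g) <= \rank (kermx A) - \rank B)%N.
Proof.
move=> fA BA Bg; rewrite -(mxrank_mul_ker (kermx A) g) leq_subRL.
  rewrite addnC leq_add //; apply: mxrankS.
    by rewrite submxMr // sub_kermx fA.
  by rewrite sub_capmx !sub_kermx BA Bg !eqxx.
apply: leq_trans (leq_addl _ _); apply: mxrankS.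
by rewrite sub_capmx !sub_kermx BA Bg !eqxx.
Qed.

(** * Squarefree monomial ideals and their resolutions *)

Section MonomialIdeals.
Variables (F : fieldType) (m : nat).
Local Notation S := {mpoly F[m]}.
Implicit Types (T : seq {set 'I_m}) (g s : {set 'I_m}) (p q : S).

Definition sqfree s : S := \prod_(i in s) 'X_i.

Lemma sqfreeE s : sqfree s = 'X_[mesym1 s].
Proof.
rewrite /sqfree -(big_morph _ (@mpolyXD _ F) (mpolyX0 _ F)).
congr 'X_[_]; apply/mnmP => i.
rewrite mnm_sumE mnmE big_mkcond (bigD1 i) //= mnm1E eqxx big1 ?addn0.
  by case: (i \in s).
by move=> j ji; rewrite mnm1E (negPf ji); case: (j \in s).
Qed.

Lemma mesym1_le g (a : 'X_{1..m}) :
  reflect {in g, forall i, 0 < a i}%N (mesym1 g <= a)%MM.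
Proof.
apply: (iffP mnm_lepP) => [le_ga i ig|lt_a i].
  by apply: leq_trans (le_ga i); rewrite mnmE ig.
by rewrite mnmE; case: (boolP (i \in g)) => // /lt_a.
Qed.

Lemma mesym1_leS g s : (mesym1 g <= mesym1 s)%MM = (g \subset s).
Proof.
apply/mesym1_le/subsetP => H i /H; first by rewrite mnmE; case: (i \in s).
by rewrite mnmE => ->.
Qed.

(** A monomial ideal contains a polynomial exactly when it contains all its monomials; by
    [mideal_sqfree] and [mideal_least] this is the ideal generated by the [sqfree F g], [g] in
    [T]. *)
Definition mideal T p : Prop :=
  {in msupp p, forall a, has (fun g => mesym1 g <= a)%MM T}.

Lemma mideal_ideal T : ideal (mideal T).
Proof.
split=> [a|p q Ip Iq a|c p Ip a].
- by rewrite msupp0.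
- by move/msuppD_le; rewrite mem_cat => /orP[/Ip|/Iq].
- case/msuppM_le/allpairsP => -[a1 a2] /= [_ /Ip /hasP[g gT le_ga] ->].
  by apply/hasP; exists g => //; apply: lepm_trans le_ga (lem_addl _ _).
Qed.

Lemma mideal_monomial T c a :
  has (fun g => mesym1 g <= a)%MM T -> mideal T (c *: 'X_[a]).
Proof. by move=> Ta b /msuppZ_le /mem_msuppXP <-. Qed.

Lemma mideal_sqfree T s g : g \in T -> g \subset s -> mideal T (sqfree s).
Proof.
move=> gT gs; rewrite sqfreeE -[X in mideal _ X]scale1r.
by apply: mideal_monomial; apply/hasP; exists g; rewrite ?mesym1_leS.
Qed.

Lemma mideal_sub T T' p : {subset T <= T'} -> mideal T p -> mideal T' p.
Proof.
by move=> sT Ip a /Ip /hasP[g gT ga]; apply/hasP; exists g; rewrite ?sT.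
Qed.

Lemma mideal_least T (I : S -> Prop) p :
  ideal I -> {in T, forall g, I (sqfree g)} -> mideal T p -> I p.
Proof.
move=> idI TI Tp; rewrite [p]mpolyE big_seq.
apply: big_ind => [||a /Tp/hasP[g gT le_ga]].
- exact: ideal0.
- exact: idealD.
rewrite -(submK le_ga) mpolyXD scalerAl -sqfreeE.
by apply: (idealM idI); apply: TI.
Qed.

Lemma mideal_nil p : mideal [::] p <-> p = 0.
Proof.
split=> [p0|->]; last exact: (ideal0 (mideal_ideal _)).
by apply: (mideal_least (I := eq^~ 0)) p0 => //; split=> // [? ? -> ->|? ? ->];
  rewrite ?addr0 ?mulr0.
Qed.

Lemma mideal_cons g T p :
  mideal (g :: T) p <-> exists q, mideal T (p - sqfree g * q).
Proof.
split=> [|[q Tq]].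
  apply: (mideal_least (I := fun p => exists q, mideal T (p - sqfree g * q))).
    split=> [|p1 p2 [q1 I1] [q2 I2]|c p1 [q1 I1]].
    - by exists 0; rewrite mulr0 subr0; apply: (ideal0 (mideal_ideal _)).
    - exists (q1 + q2); rewrite mulrDr opprD addrACA.
      exact: (idealD (mideal_ideal _)).
    - exists (c * q1); rewrite mulrCA -mulrBr.
      exact: (idealM (mideal_ideal _)).
  move=> h; rewrite inE => /predU1P[-> | hT].
    by exists 1; rewrite mulr1 subrr; apply: (ideal0 (mideal_ideal _)).
  by exists 0; rewrite mulr0 subr0; apply: mideal_sqfree hT _.
apply: (ideal_subl (mideal_ideal _)) (_ : mideal _ (sqfree g * q)).
  by apply: mideal_sub Tq => h hT; rewrite inE hT orbT.
rewrite mulrC; apply: (idealM (mideal_ideal _)).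
by apply: (mideal_sqfree (g := g)); rewrite ?mem_head.
Qed.

(** A squarefree [x^t] divides [x^g x^b] iff [x^(t :\: g)] divides [x^b]. Hence the colon ideal is
    again squarefree, on a list of the same length. *)
Lemma mideal_colon g T q :
  mideal [seq t :\: g | t <- T] q <-> mideal T (sqfree g * q).
Proof.
have le_colon t b :
    (mesym1 (t :\: g) <= b)%MM = (mesym1 t <= mesym1 g + b)%MM.
  apply/mesym1_le/mesym1_le => H i.
    move=> it; rewrite mnmDE mnmE; case: (boolP (i \in g)) => //= ig.
    by rewrite H // inE ig.
  by rewrite inE => /andP[ig /H]; rewrite mnmDE mnmE (negPf ig).
rewrite sqfreeE mulrC /mideal; split=> Iq a.
  rewrite (perm_mem (msuppMX _ _)) => /mapP[b /Iq + ->].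
  by rewrite has_map; apply: sub_has => t /=; rewrite le_colon.
move=> aq; rewrite has_map.
have /Iq : (mesym1 g + a)%MM \in msupp (q * 'X_[mesym1 g]).
  by rewrite (perm_mem (msuppMX _ _)) map_f.
by apply: sub_has => t /=; rewrite le_colon.
Qed.

Lemma resolves_koszul_nil : resolves (mideal [::]) (koszul [::] : cplx S).
Proof.
have augE (v : 'rV[S]_1) : augment (koszul [::]) v = v 0 0.
  by rewrite /augment mulmx1.
split=> [p|v|i v].
- by exists p%:M; rewrite augE mxE eqxx mulr1n subrr; apply/mideal_nil.
- rewrite augE; split=> [/mideal_nil v0|[w ->]].
    by exists 0; rewrite mulmx0 [v]mx11_scalar v0 raddf0.
  by rewrite mulmx0 mxE; apply/mideal_nil.
- by split=> _; [exists 0; rewrite mulmx0 [v]thinmx0 | rewrite mulmx0].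
Qed.

(** Distinct variables form a regular sequence: removing [j] from the other singletons changes
    nothing, so the colon ideal by ['X_j] is the ideal itself. *)
Lemma resolves_koszul (l : seq 'I_m) : uniq l ->
  resolves (mideal [seq [set j] | j <- l]) (koszul [seq 'X_j : S | j <- l]).
Proof.
elim: l => [|j l IHl] /=; first by move=> _; apply: resolves_koszul_nil.
case/andP=> jl /IHl resl.
have Xj : 'X_j = sqfree [set j] by rewrite /sqfree big_set1.
apply: (resolves_cone (x := 'X_j) (mideal_ideal _) _ _ resl resl).
- move=> q; rewrite Xj -mideal_colon -map_comp.
  suff /eq_in_map-> : {in l, (fun t => t :\: [set j]) \o set1 =1 set1} by [].
  move=> k kl; apply/setP => i; rewrite !inE andbC.
  by case: (i =P k) => //= ->; apply: contra jl => /eqP <-.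
- by move=> p; rewrite mideal_cons Xj.
- exact: koszul_chain_map.
- move=> v; rewrite mul_mx_scalar /augment -scalemxAl mxE subrr.
  exact: (ideal0 (mideal_ideal _)).
Qed.

(** A new generator [g] is added by the cone of a lift of multiplication by [x^g], and Pascal's rule
    gives the ranks. The induction is on length because the colon ideal has a different list of
    generators. *)
Lemma exists_resolution T :
  exists2 C : cplx S, resolves (mideal T) C &
    forall i, rk C i = 'C(size T, i).
Proof.
have [n] := ubnP (size T); elim: n T => // n IHn [|g T] /=; rewrite ltnS => sT.
  by exists (koszul [::]); [apply: resolves_koszul_nil | case].
have [P resP rkP] := IHn T sT.
have [|Q resQ rkQ] := IHn [seq t :\: g | t <- T]; first by rewrite size_map.
have [v|f chf f0] := lift_chain_map (a := sqfree g *: aug Q)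
    (mideal_ideal T) resP (fun i => resolves_sq0 i resQ).
  rewrite -scalemxAr mxE; apply/mideal_colon; exact: resolves_aug0 resQ.
exists (cone f); last first.
  by case=> [|i] /=; rewrite rkP ?bin0 // rkQ size_map binS.
apply: (resolves_cone (mideal_ideal T) (mideal_colon g T) (mideal_cons g T)
  resP resQ chf) => v.
by have := f0 v; rewrite -scalemxAr mxE.
Qed.

End MonomialIdeals.

(** * Specialization to a line through the origin *)

Section Specialization.
Variables (F : fieldType) (m : nat).
Local Notation S := {mpoly F[m]}.
Local Notation const := (mcoeff 0%MM : S -> F).

(** An invertible square compression of the matrix at [t = 0] lifts to a matrix over [F[t]] whose
    determinant is 1 at 0, hence nonzero in [E]. *)
Lemma mxrank_specialize (E : fieldType) (psi : {rmorphism S -> {poly F}})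
    (iota : {rmorphism {poly F} -> E}) k n (A : 'M[S]_(k, n)) :
    injective iota -> (forall p, (psi p).[0] = const p) ->
  (\rank (map_mx const A) <= \rank (map_mx (iota \o psi) A))%N.
Proof.
move=> inj_iota psi0; set A0 := map_mx const A.
pose L := pinvmx (col_base A0); pose R := pinvmx (row_base A0).
have LAR : L *m A0 *m R = 1%:M.
  have -> : L *m A0 = L *m (col_base A0 *m row_base A0) by rewrite mulmx_base.
  rewrite mulmxA mulVpmx ?col_base_full // mul1mx.
  by rewrite mulmxVp ?row_base_free.
pose B := map_mx polyC L *m map_mx psi A *m map_mx polyC R.
have evalK a b (M : 'M[F]_(a, b)) : map_mx (horner_eval 0 \o polyC) M = M.
  by apply/matrixP => i j; rewrite mxE /= /horner_eval hornerC.
have B0 : map_mx (horner_eval 0) B = 1%:M.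
  rewrite -LAR !map_mxM -!map_mx_comp.
  rewrite !evalK; congr (_ *m _ *m _).
  by apply/matrixP => i j; rewrite !mxE /= /horner_eval psi0.
have detB : \det B != 0.
  apply/eqP => detB; have /eqP := det1 F (\rank A0).
  by rewrite -B0 det_map_mx detB rmorph0 eq_sym oner_eq0.
have unitB : map_mx iota B \in unitmx.
  by rewrite unitmxE det_map_mx unitfE raddf_eq0.
rewrite -(mxrank_unit unitB) !map_mxM -map_mx_comp.
by apply: leq_trans (mxrankM_maxl _ _) (mxrankM_maxr _ _).
Qed.

Definition line_spec (s : {set 'I_m}) : S -> {poly F} :=
  mmap polyC (fun i => if i \in s then 'X else 0).

HB.instance Definition _ s := GRing.RMorphism.on (line_spec s).

Lemma line_specX s i : line_spec s 'X_i = if i \in s then 'X else 0.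
Proof. by rewrite /line_spec mmapX mmap1U. Qed.

Lemma line_spec_at0 s p : (line_spec s p).[0] = const p.
Proof.
elim/mpolyind: p => [|c a p _ _ IHp]; first by rewrite !raddf0 horner0.
rewrite mcoeffD -IHp /line_spec mmapD hornerD; congr (_ + _).
rewrite mmapZ mmapX hornerM hornerC /= mcoeffZ mcoeffX; congr (_ * _).
have [->|a_neq0] := eqVneq a 0%MM; first by rewrite mmap11 hornerC.
have [i ai0] : exists i, a i != 0%N.
  apply/existsP; apply: contraR a_neq0; rewrite negb_exists => /forallP a0.
  by apply/eqP/mnmP => i; rewrite mnm0E; apply/eqP; have := a0 i; rewrite negbK.
rewrite /mmap1 horner_prod (bigD1 i) //= horner_exp.
by case: ifP => _; rewrite ?hornerX ?horner0 expr0n (negPf ai0) mul0r.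
Qed.

End Specialization.

(** * Lower bounds for Tor *)

Section TorBounds.
Variables (F : fieldType) (m : nat) (I : {mpoly F[m]} -> Prop).
Hypothesis idI : ideal I.
Variable P : free_resolution I.
Local Notation S := {mpoly F[m]}.
Local Notation const := (mcoeff 0%MM : S -> F).

Definition res_cplx : cplx S := Cplx (res_aug P) (res_diff P).

Lemma resolves_res_cplx : resolves I res_cplx.
Proof.
split; [exact: res_aug_surj | exact: res_exact0 | exact: res_exactS].
Qed.

Lemma dim_Tor_le i : (dim_Tor P i <= res_rk P i)%N.
Proof.
case: i => [|i] /=; first exact: leq_subr.
by rewrite mxrank_ker (leq_trans (leq_subr _ _)) ?leq_subr.
Qed.

(** The two hypotheses make [I] agree with the ideal of the variables off [s] wherever [x^s] is
    invertible. There Koszul homology gives the binomials, and homology can only grow at the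
    origin. *)
Lemma dim_Tor_ge_binomial (s : {set 'I_m}) i :
    (forall p, I p -> mideal [seq [set j] | j <- enum (~: s)] p) ->
    (forall j, j \notin s -> I (sqfree F s * 'X_j)) ->
  ('C(m - #|s|, i) <= dim_Tor P i)%N.
Proof.
move=> I_sub I_sup; have resP := resolves_res_cplx.
pose l := [seq (sqfree F s, 'X_j : S) | j <- enum (~: s)].
pose C := koszul [seq p.1 * p.2 | p <- l]; pose D := koszul [seq p.2 | p <- l].
pose ID := mideal (F := F) [seq [set j] | j <- enum (~: s)].
have idID : ideal ID by apply: mideal_ideal.
have resD : resolves ID D.
  by rewrite /D -map_comp; apply: resolves_koszul; apply: enum_uniq.
have sq0C j : df C j.+1 *m df C j = 0 by apply: koszul_sq0.
have gensC x : x \in [seq p.1 * p.2 | p <- l] -> I x.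
  rewrite -map_comp => /mapP[j]; rewrite mem_enum inE => js ->.
  exact: I_sup.
have [f chf f0] := lift_chain_map idI resP sq0C
  (fun v => koszul_aug0 v idI gensC).
have [v|g chg g0] := lift_chain_map (C := res_cplx) (a := res_aug P) idID resD
    (fun j => resolves_sq0 j resP).
  by apply: I_sub; apply: resolves_aug0 resP.
(* Both terms lift the projection to the quotient by the variables off [s], so [h] is
   null-homotopic. *)
pose h j := f j *m g j - koszul_diag l j.
have chh : chain_map (C := C) (D := D) h.
  move=> j; rewrite /h mulmxBr mulmxBl mulmxA chf -!mulmxA chg.
  by rewrite (koszul_diag_chain_map l).
have h0 (v : 'rV_(rk C 0)) : ID (augment D (v *m h 0)).
  rewrite /h mulmxBr augmentD augmentN mulmxA {2}/augment.
  rewrite -[_ *m koszul_diag l 0 *m _]mulmxA koszul_diag_aug.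
  exact: ideal_trans idID (g0 _) (I_sub _ (f0 v)).
have [[W hW] hWS] := null_homotopy resD sq0C chh h0.
pose psi : {rmorphism S -> {fraction {poly F}}} :=
  @tofrac {poly F} \o @line_spec F m s.
have psiX j : psi 'X_j = if j \in s then tofrac 'X else 0.
  by rewrite /= line_specX; case: ifP; rewrite ?tofrac0.
have dC j : map_mx psi (df C j) = 0.
  apply: map_koszul_df => x; rewrite -map_comp => /mapP[k].
  rewrite mem_enum inE => ks ->.
  by rewrite rmorphM psiX (negPf ks) mulr0.
have dD j : map_mx psi (df D j) = 0.
  apply: map_koszul_df => x; rewrite -map_comp => /mapP[k].
  by rewrite mem_enum inE => ks ->; rewrite psiX (negPf ks).
have fg j : map_mx psi (f j *m g j) = map_mx psi (koszul_diag l j).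
  apply/eqP; rewrite -subr_eq0 -map_mxB -/(h j); apply/eqP.
  case: j => [|j]; first by rewrite hW map_mxM dD mulmx0.
  have [V [V' ->]] := hWS j.
  by rewrite map_mxD !map_mxM dC dD mul0mx mulmx0 addr0.
have rank_fg j : \rank (map_mx psi (f j *m g j)) = 'C(m - #|s|, j).
  have <- : size l = (m - #|s|)%N.
    by rewrite size_map -cardE [LHS]cardsCs setCK card_ord.
  rewrite fg; apply: rank_koszul_diag => p /mapP[k _ ->].
  rewrite [_.1]/= /sqfree rmorph_prod; apply/prodf_neq0.
  by move=> a sa; rewrite psiX sa tofrac_eq0 polyX_eq0.
have rank_le j :
    (\rank (tensor_diff P j) <= \rank (map_mx psi (res_diff P j)))%N.
  apply: mxrank_specialize; last exact: line_spec_at0.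
  by move=> x y /eqP; rewrite tofrac_eq => /eqP.
have Bg j : map_mx psi (res_diff P j) *m map_mx psi (g j) = 0.
  by rewrite -map_mxM (chg j) map_mxM dD mulmx0.
rewrite -rank_fg map_mxM; case: i => [|i] /=.
  (* In degree 0 the outgoing differential is the map to the zero space. *)
  apply: leq_trans (mxrank_factor_homology (A := 0 : 'M_(_, 0)) _ _ (Bg 0)) _.
  - exact: mulmx0.
  - exact: mulmx0.
  - by rewrite mxrank_ker mxrank0 subn0 leq_sub2l.
apply: leq_trans (mxrank_factor_homology (A := map_mx psi (res_diff P i))
  _ _ (Bg i.+1)) _.
- by rewrite -map_mxM -(chf i) map_mxM dC mul0mx.
- by rewrite -map_mxM (resolves_sq0 i resP) map_mx0.
- by rewrite !mxrank_ker leq_sub // leq_sub2l.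
Qed.

(* The entries of a syzygy of minimal monomial generators have no constant    *)
(* term, so lifting the identity of [S/I] through [P] gives the identity of   *)
(* [F^N] in degree 1.                                                         *)
Lemma dim_Tor1_ge_card (N : {set {set 'I_m}}) :
    (forall p, I p <-> mideal (enum N) p) ->
    {in N &, forall g h : {set 'I_m}, g \subset h -> g = h} -> set0 \notin N ->
  (#|N| <= dim_Tor P 1)%N.
Proof.
move=> IE antiN N0; have resP := resolves_res_cplx.
pose mc : 'cV[S]_#|N| := \col_i sqfree F (enum_val i).
have IN i : I (mc i 0).
  rewrite mxE; apply/IE; apply: mideal_sqfree (subxx _).
  by rewrite mem_enum enum_valP.
have gen p : I p -> exists w : 'rV_#|N|, p%:M = w *m mc.
  move/IE; apply: (mideal_least (I := fun p => exists w, p%:M = w *m mc)).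
    split=> [|p1 p2 [w1 E1] [w2 E2]|c q [w E]].
    - by exists 0; rewrite mul0mx raddf0.
    - by exists (w1 + w2); rewrite mulmxDl raddfD /= E1 E2.
    - by exists (c *: w); rewrite -scalemxAl -E scale_scalar_mx.
  move=> g; rewrite mem_enum => gN; exists (delta_mx 0 (enum_rank_in gN g)).
  rewrite -rowE [row _ _]mx11_scalar !mxE.
  by rewrite enum_rankK_in.
have coef_lead (p : S) a : (p * 'X_[a])@_a = const p.
  by rewrite -[X in mcoeff X]addm0 mcoeffMX.
(* At the monomial of generator [j], the other generators contribute nothing, as none divides it;
   the constant term of entry [j] remains. *)
have syz k (A : 'M_(k, #|N|)) : A *m mc = 0 -> map_mx const A = 0.
  move=> A0; apply/matrixP => i j; rewrite !mxE.
  have /matrixP/(_ i 0) := A0; rewrite !mxE.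
  move/(congr1 (mcoeff (mesym1 (enum_val j)))).
  rewrite mcoeff0 raddf_sum (bigD1 j) //= big1 => [|l lj].
    by rewrite addr0 mxE sqfreeE coef_lead.
  rewrite mxE sqfreeE; apply/memN_msupp_eq0.
  rewrite (perm_mem (msuppMX _ _)); apply/mapP => -[b _ E].
  case/eqP: lj; apply/enum_val_inj/antiN; rewrite ?enum_valP //.
  by rewrite -mesym1_leS E lem_addr.
have [v0 v0P] := resolves_surj resP 1.
set c := augment res_cplx v0 in v0P.
(* [I] has no constant terms because the empty set is not in [N]. *)
have c1 : const c = 1.
  suff /eqP : const (c - 1) = 0 by rewrite rmorphB rmorph1 subr_eq0 => /eqP.
  apply: memN_msupp_eq0; apply/negP => /((IE _).1 v0P)/hasP[g].
  rewrite mem_enum => gN.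
  rewrite -mesym1_set0 mesym1_leS subset0 => /eqP g0.
  by move: N0; rewrite -g0 gN.
have Imc (w : 'rV_#|N|) : I ((w *m mc) 0 0).
  rewrite mxE.
  apply: big_ind => [||i _]; [exact: ideal0 idI | exact: idealD idI |].
  exact: (idealM idI).
have v0c : v0 *m res_aug P = c%:M by rewrite [LHS]mx11_scalar.
have [f1 f1P] : exists W, mc *m v0 = W *m res_diff P 0.
  apply: (resolves_lift0 resP) => w; rewrite /augment /=.
  rewrite mulmxA -mulmxA v0c mul_mx_scalar mxE.
  by apply: (idealM idI).
have [g1 g1P] : exists W, res_diff P 0 *m res_aug P = W *m mc.
  apply: mx_rowwise => v; rewrite mulmxA.
  have [w wP] := gen _ (resolves_aug0 (C := res_cplx) v resP); exists w.
  by rewrite -wP [LHS]mx11_scalar.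
have f1g1 : map_mx const (f1 *m g1) = 1%:M.
  have : map_mx const (f1 *m g1 - c%:M) = 0.
    apply: syz; rewrite mulmxBl -mulmxA -g1P mulmxA -f1P -mulmxA v0c.
    by rewrite mul_mx_scalar mul_scalar_mx subrr.
  by rewrite map_mxB map_scalar_mx /= c1 => /eqP; rewrite subr_eq0 => /eqP.
have cmc : map_mx const mc = 0.
  apply/matrixP => i j; rewrite !mxE sqfreeE mcoeffX -mesym1_set0.
  rewrite (inj_eq (@inj_mesym1 _)).
  by case: eqP => // E; move: N0; rewrite -E enum_valP.
have -> : #|N| = \rank (map_mx const f1 *m map_mx const g1).
  by rewrite -map_mxM f1g1 mxrank1.
apply: mxrank_factor_homology.
- by rewrite -map_mxM -f1P map_mxM cmc mul0mx.
- by rewrite -map_mxM (resolves_sq0 0 resP) map_mx0.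
- rewrite -map_mxM; apply: syz.
  by rewrite -mulmxA -g1P mulmxA (resolves_sq0 0 resP) mul0mx.
Qed.

End TorBounds.

(** * Minimal nonfaces, facets and the Stanley-Reisner ideal *)

Section SimplicialComplexes.
Variable m : nat.
Implicit Types (K : simplicial_complex m) (s t : {set 'I_m}).

Definition min_nonfaces K : {set {set 'I_m}} :=
  [set s | minset [pred t | t \notin faces K] s].

Lemma min_nonfaceP K s :
  reflect (s \notin faces K /\
           forall t, t \notin faces K -> t \subset s -> t = s)
          (s \in min_nonfaces K).
Proof. by rewrite inE; apply: minsetP. Qed.

Lemma min_nonface_exists K s : s \notin faces K ->
  exists2 t, t \in min_nonfaces K & t \subset s.
Proof.
move=> sK; have [t mt ts] := @minset_exists _ [pred t | t \notin faces K] s sK.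
by exists t; rewrite ?inE.
Qed.

Lemma facetP K s :
  reflect (s \in faces K /\ forall t, t \in faces K -> s \subset t -> t = s)
          (s \in facets K).
Proof. by rewrite inE; apply: maxsetP. Qed.

Lemma mdim_facet K : exists s, [/\ s \in facets K,
  mdim K = #|s|%:Z - 1 & forall t, t \in facets K -> (#|s| <= #|t|)%N].
Proof.
rewrite /mdim; set d := (\big[_/_]_(s in _) _)%N.
have d_le t : t \in facets K -> (d <= #|t|)%N.
  move=> Kt; have := mem_index_enum t; rewrite /d.
  elim: (index_enum _) => // u r IHr; rewrite inE big_cons.
  case/predU1P=> [<-|/IHr le_r]; first by rewrite Kt geq_minl.
  by case: ifP => // _; rewrite geq_min le_r orbT.
have [t0 mt0 _] :=
  @maxset_exists _ [pred t | t \in faces K] set0 (faces_set0 K).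
have Kt0 : t0 \in facets K by rewrite inE.
suff [s Ks sd] : exists2 s, s \in facets K & #|s| = d.
  by exists s; split=> [|| t /d_le]; rewrite ?sd.
have : d = m \/ exists2 s, s \in facets K & #|s| = d.
  rewrite /d.
  apply: (big_ind (fun x => x = m \/ exists2 s, s \in facets K & #|s| = x)) =>
    [|x y IHx IHy|s Ks]; [by left| |by right; exists s].
  by case: (leqP x y).
(* If the minimum is the default [m], every facet has at least [m] elements, hence exactly [m]. *)
case=> // dm; exists t0 => //; apply/eqP; rewrite eqn_leq d_le // andbT dm.
by rewrite -[X in (_ <= X)%N]card_ord max_card.
Qed.

Section StanleyReisner.
Variable F : fieldType.

Lemma SR_ideal_ideal K : ideal (@SR_ideal F m K).
Proof.
split=> [|p q [c1 ->] [c2 ->]|c p [c1 ->]].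
- by exists (fun=> 0); rewrite big1 // => s _; rewrite mul0r.
- exists (fun s => c1 s + c2 s); rewrite -big_split /=.
  by apply: eq_bigr => s _; rewrite mulrDl.
- exists (fun s => c * c1 s); rewrite mulr_sumr.
  by apply: eq_bigr => s _; rewrite mulrA.
Qed.

Lemma SR_ideal_nonface K s : s \notin faces K -> SR_ideal K (sqfree F s).
Proof.
move=> sK; exists (fun t => (t == s)%:R); rewrite (bigD1 s) //= eqxx mul1r.
by rewrite [X in _ + X]big1 ?addr0 // => t /andP[_ /negPf->]; rewrite mul0r.
Qed.

Lemma SR_idealE K (p : {mpoly F[m]}) :
  SR_ideal K p <-> mideal (enum (min_nonfaces K)) p.
Proof.
split=> [[c ->]|].
  have idN := mideal_ideal F (enum (min_nonfaces K)).
  apply: (big_ind (mideal _)) => [||s sK]; [exact: ideal0|exact: idealD|].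
  apply: (idealM idN).
  have [t tN ts] := min_nonface_exists sK.
  by rewrite -mem_enum in tN; apply: mideal_sqfree tN ts.
apply: (mideal_least (SR_ideal_ideal K)) => s; rewrite mem_enum.
by case/min_nonfaceP => sK _; apply: SR_ideal_nonface.
Qed.

(** A nonface is not inside [s], so it has a vertex off [s]; by maximality [j |: s] is a nonface for
    each [j] off [s]. These are the two inclusions required. *)
Lemma facet_dim_Tor_ge K (P : free_resolution (@SR_ideal F m K)) s i :
  s \in facets K -> ('C(m - #|s|, i) <= dim_Tor P i)%N.
Proof.
move=> /facetP[sK maxs]; apply: (dim_Tor_ge_binomial (SR_ideal_ideal K)).
  have idT := mideal_ideal F [seq [set j] | j <- enum (~: s)].
  move=> p /SR_idealE; apply: (mideal_least idT) => g.
  rewrite mem_enum => /min_nonfaceP[gK _].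
  have /subsetPn[j jg js] : ~~ (g \subset s).
    by apply: contra gK => gs; apply: faces_sub gs sK.
  have jT : [set j] \in [seq [set j] | j <- enum (~: s)].
    by apply: map_f; rewrite mem_enum inE.
  by apply: mideal_sqfree jT _; rewrite sub1set.
move=> j js; rewrite mulrC.
have -> : 'X_j * sqfree F s = sqfree F (j |: s) by rewrite /sqfree big_setU1.
apply: SR_ideal_nonface; apply: contra js => /maxs <-; first exact: setU11.
exact: subsetU1.
Qed.

Lemma dim_Tor1_ge_min_nonfaces K (P : free_resolution (@SR_ideal F m K)) :
  (#|min_nonfaces K| <= dim_Tor P 1)%N.
Proof.
apply: (dim_Tor1_ge_card (SR_ideal_ideal K)).
- exact: SR_idealE.
- move=> g h /min_nonfaceP[gK _] /min_nonfaceP[_ minh] gh; exact: minh.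
- by apply/negP => /min_nonfaceP[]; rewrite faces_set0.
Qed.

End StanleyReisner.

(* Minimal nonfaces are the sets [{j} :|: U_j] for some vertices [j] outside  *)
(* [s], at most one for each [j], with [U_j \subset s].                       *)
Definition split_nonfaces K s : Prop :=
  (forall g, g \in min_nonfaces K -> exists j, g :\: s = [set j]) /\
  {in min_nonfaces K &, injective (fun g => g :\: s)}.

Lemma sum_binomial k n : (k < n)%N -> (\sum_(i < n) 'C(k, i) = 2 ^ k)%N.
Proof.
move=> kn; rewrite -(big_mkord xpredT (fun i => 'C(k, i))).
rewrite (big_cat_nat (n := k.+1)) //= [X in (_ + X)%N]big1_seq ?addn0.
  rewrite big_mkord -[2%N]/(1 + 1)%N expnDn.
  by apply: eq_bigr => i _; rewrite !exp1n !muln1.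
by move=> i /andP[_]; rewrite mem_index_iota => /andP[ki _]; rewrite bin_small.
Qed.

Lemma weakly_taut_split F K :
  weakly_taut F K -> exists s, split_nonfaces K s.
Proof.
case=> d [[P [n [P0 ->]]]]; have [s [Ks -> _]] := mdim_facet K.
have sm : (#|s| <= m)%N by rewrite -[X in (_ <= X)%N]card_ord max_card.
set k := (m - #|s|)%N; have -> : m%:Z - (#|s|%:Z - 1) - 1 = k%:Z.
  by rewrite opprB addrA addrAC addrK subzn.
rewrite -exprnP -natrX => /eqP; rewrite eqr_nat => /eqP sum2k.
have geC i : ('C(k, i) <= dim_Tor P i)%N by apply: facet_dim_Tor_ge.
have kn : (k < n)%N.
  by rewrite ltnNge; apply/negP => /P0 Pk; have := geC k; rewrite Pk binn.
have leN : (#|min_nonfaces K| <= k)%N.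
  apply: leq_trans (dim_Tor1_ge_min_nonfaces P) _.
  have [n1|n1] := leqP n 1; first by rewrite P0.
  move: sum2k; rewrite -(sum_binomial kn).
  (* The sums agree and dominate termwise, so cancelling all other degrees leaves
     [dim Tor_1 <= k]. *)
  rewrite (bigD1 (Ordinal n1)) //= [RHS](bigD1 (Ordinal n1)) //= bin1 => E.
  rewrite -(leq_add2r (\sum_(i < n | i != Ordinal n1) 'C(k, i))) -E.
  by rewrite leq_add2l leq_sum.
have [sK maxs] := facetP _ _ Ks.
have /fin_all_exists[f fP] j : exists g,
    j \notin s -> g \in min_nonfaces K /\ g :\: s = [set j].
  have [js|js] := boolP (j \in s); first by exists set0.
  have /min_nonface_exists[g gN gs] : j |: s \notin faces K.
    by apply: contra js => /maxs <-; rewrite ?setU11 ?subsetU1.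
  exists g => _; split=> //; apply/eqP; rewrite eqEsubset; apply/andP; split.
    by rewrite subDset setUC.
  rewrite sub1set inE js; have /min_nonfaceP[gK _] := gN.
  apply: contraR gK => jg; apply: faces_sub sK; apply/subsetP => i ig.
  have := subsetP gs i ig; rewrite !inE => /predU1P[ij|//].
  by rewrite -ij ig in jg.
(* The [k] nonfaces [f j] are distinct, and there are at most [k] minimal ones. *)
have fN : f @: (~: s) = min_nonfaces K.
  apply/eqP; rewrite eqEcard; apply/andP; split.
    by apply/subsetP => _ /imsetP[j + ->]; rewrite inE => /fP[].
  rewrite card_in_imset.
    by rewrite [X in (_ <= X)%N]cardsCs setCK card_ord.
  move=> i j; rewrite !inE => /fP[_ fi] /fP[_ fj] fij.
  by apply/set1P; rewrite -fj -fij fi set11.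
exists s; split; rewrite -fN.
  by move=> _ /imsetP[j + ->]; rewrite inE => /fP[_ ->]; exists j.
move=> _ _ /imsetP[i + ->] /imsetP[j + ->]; rewrite !inE.
move=> /fP[_ ->] /fP[_ ->] /set1_inj ->.
by [].
Qed.

(** The facet is the complement of the set [e] of selected vertices. It omits a vertex of each
    minimal nonface; since [e] avoids [s], putting back one vertex of [e] completes its nonface. *)
Lemma split_facet K s : split_nonfaces K s ->
  exists2 t, t \in facets K & #|min_nonfaces K| = (m - #|t|)%N.
Proof.
case=> sgl inj_s.
pose e := [set j | [exists g in min_nonfaces K, g :\: s == [set j]]].
have eP j :
    reflect (exists2 g, g \in min_nonfaces K & g :\: s = [set j]) (j \in e).
  by rewrite inE; apply: 'exists_in_eqP.
have card_e : #|e| = #|min_nonfaces K|.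
  rewrite -(card_imset (mem e) set1_inj) -(card_in_imset inj_s).
  apply: eq_card => u; apply/imsetP/imsetP => [[j /eP[g gN gj] ->]|[g gN ->]].
    by exists g.
  by have [j gj] := sgl g gN; exists j => //; apply/eP; exists g.
exists (~: e); last by rewrite -card_e [LHS]cardsCs card_ord.
have tK : ~: e \in faces K.
  apply/negPn/negP => /min_nonface_exists[g gN /subsetP gt].
  have [j gj] := sgl g gN; have : j \in g :\: s by rewrite gj set11.
  rewrite inE => /andP[_ /gt]; rewrite inE => /negP[].
  by apply/eP; exists g.
apply/facetP; split=> // u uK tu; apply/eqP; rewrite eqEsubset tu andbT.
apply/subsetP => x xu; rewrite inE; apply/negP => /eP[g gN gx].
have /min_nonfaceP[/negP gK _] := gN; apply: gK; apply: faces_sub uK.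
apply/subsetP => y yg; have [ys|ys] := boolP (y \in s).
  apply: (subsetP tu); rewrite inE; apply/negP => /eP[h _ hy].
  have : y \in h :\: s by rewrite hy set11.
  by rewrite inE ys.
have : y \in g :\: s by rewrite inE ys.
by rewrite gx => /set1P ->.
Qed.

Lemma split_weakly_taut (F : fieldType) K s :
  split_nonfaces K s -> weakly_taut F K.
Proof.
case/split_facet => t Kt; set r := #|min_nonfaces K| => rt.
have [C resN rkC] := exists_resolution F (enum (min_nonfaces K)).
have resC : resolves (@SR_ideal F m K) C.
  by apply: eq_resolves resN => p; split=> /SR_idealE.
pose P := FreeResolution (resolves_surj resC) (resolves0 resC) (resolvesS resC).
have dimP i : dim_Tor P i = 'C(r, i).
  apply/eqP; rewrite eqn_leq {2}rt facet_dim_Tor_ge // andbT.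
  by apply: leq_trans (dim_Tor_le P i) _; rewrite /= rkC -cardE.
exists (2 ^ r)%N; split.
  exists P, r.+1; split=> [i ri|]; first by rewrite dimP bin_small.
  by rewrite -(sum_binomial (ltnSn r)); apply: eq_bigr => i _; rewrite dimP.
have [u [Ku -> minu]] := mdim_facet K.
have cardm (v : {set 'I_m}) : (#|v| <= m)%N.
  by rewrite -[X in (_ <= X)%N]card_ord max_card.
(* Otherwise the facet bound of [u] in degree [m - #|u|] would be 1, where Tor already vanishes. *)
have ur : (m - #|u| <= r)%N.
  rewrite leqNgt; apply/negP => /bin_small ru.
  by have := facet_dim_Tor_ge P (m - #|u|) Ku; rewrite dimP ru binn.
have -> : m%:Z - (#|u|%:Z - 1) - 1 = r%:Z.
  rewrite opprB addrA addrAC addrK subzn //; congr Posz.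
  by apply/eqP; rewrite eqn_leq ur rt leq_sub2l // minu.
by rewrite -exprnP -natrX.
Qed.

End SimplicialComplexes.

(** * Passage to full subcomplexes *)

(** Relabelling embeds the minimal nonfaces of the subcomplex into those of [K] and commutes with
    removing [s], so both conditions pull back along it. *)
Lemma split_full_subcomplex (m : nat) (K : simplicial_complex m)
    (J s : {set 'I_m}) :
  split_nonfaces K s ->
  split_nonfaces (full_subcomplex K J) [set j | enum_val j \in s].
Proof.
case=> sgl inj_s; set s' := [set j | _]; pose v (j : 'I_#|J|) := enum_val j.
have inj_v : injective v by apply: enum_val_inj.
have faceE g : (g \in faces (full_subcomplex K J)) = (v @: g \in faces K).
  by rewrite inE.
have imN g : g \in min_nonfaces (full_subcomplex K J) ->
    v @: g \in min_nonfaces K.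
  case/min_nonfaceP; rewrite faceE => gK ming; apply/min_nonfaceP.
  split=> // t tK tg.
  have deft : v @: [set j in g | v j \in t] = t.
    apply/setP => x; apply/imsetP/idP => [[j + ->]|xt].
      by rewrite inE => /andP[].
    have /imsetP[j jg xj] := subsetP tg x xt.
    by exists j; rewrite // inE jg -xj.
  suff <- : [set j in g | v j \in t] = g by [].
  apply: ming; first by rewrite faceE deft.
  by apply/subsetP => j; rewrite inE => /andP[].
have imD g : v @: (g :\: s') = v @: g :\: s.
  apply/setP => x; rewrite inE.
  apply/imsetP/andP => [[j + ->]|[xs /imsetP[j jg xj]]].
    by rewrite !inE => /andP[js jg]; rewrite imset_f.
  by exists j; rewrite // !inE -/(v j) -xj xs.
split=> [g gN|g h gN hN gh].
  have [j gj] := sgl _ (imN g gN).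
  have /imsetP[i _ ji] : j \in v @: (g :\: s') by rewrite imD gj set11.
  by exists i; apply: (imset_inj inj_v); rewrite imD gj imset_set1 ji.
apply: (imset_inj inj_v); apply: inj_s; rewrite ?imN //=.
by rewrite -!imD gh.
Qed.

Theorem theorem1p9 (F : fieldType) (m : nat) (K : simplicial_complex m)
    (J : {set 'I_m}) :
  weakly_taut F K -> weakly_taut F (full_subcomplex K J).
Proof.
by case/weakly_taut_split => s /(split_full_subcomplex J)/split_weakly_taut.
Qed.
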